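(* Let $h\in\mathbb{N}$, $\pi\in S_h$, let $(\xi_t)_{t\ge 0}$ be a real-valued stochastic process and let $X_t:=\xi_t-\xi_{t-1}$, $t\ge 1$, be its increment process. Suppose that $(X_i)_{i\geq 1}$ is a stationary ergodic process. Then $\hat q_n(\pi)$ is a consistent estimator of $p(\pi):=P(\tilde\Pi(X_1,\ldots,X_h)=\pi)$; more precisely, \[ \lim_{n\to\infty}\hat q_n(\pi)=p(\pi)\quad\text{almost surely.} \]
   Context: $S_h$ denotes the set of permutations of $\{0,\ldots,h\}$, written as $(h+1)$-tuples. For $(x_0,\ldots,x_h)\in\mathbb{R}^{h+1}$ the ordinal pattern of order $h$ is the permutation $\Pi(x_0,\ldots,x_h)=(\pi_0,\ldots,\pi_h)\in S_h$ satisfying $x_{\pi_0}\ge\cdots\ge x_{\pi_h}$ and $\pi_{i-1}>\pi_i$ whenever $x_{\pi_{i-1}}=x_{\pi_i}$, $i=1,\ldots,h$. For $(y_1,\ldots,y_h)\in\mathbb{R}^h$ put $\tilde\Pi(y_1,\ldots,y_h):=\Pi(0,y_1,y_1+y_2,\ldots,y_1+\cdots+y_h)$. Then $\Pi(\xi_t,\ldots,\xi_{t+h})=\tilde\Pi(X_{t+1},\ldots,X_{t+h})$. The estimator is \[ \hat q_n(\pi):=\frac1n\sum_{i=0}^{n-1}1_{\{\Pi(\xi_i,\ldots,\xi_{i+h})=\pi\}}=\frac1n\sum_{i=0}^{n-1}1_{\{\tilde\Pi(X_{i+1},\ldots,X_{i+h})=\pi\}}. \] *)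

(* Defs.v *)
From mathcomp Require Import all_boot all_order all_algebra perm.
From mathcomp Require Import all_classical all_reals all_analysis.
From mathcomp Require Import measurable_realfun.

Set Implicit Arguments.
Unset Strict Implicit.
Unset Printing Implicit Defensive.

Import Order.TTheory GRing.Theory Num.Theory.
Import numFieldNormedType.Exports.

Local Open Scope classical_set_scope.
Local Open Scope ring_scope.

Section OrdinalPattern.
Context {R : realType} {h : nat}.
Implicit Types (x : 'I_h.+1 -> R) (s : 'S_h.+1).

(* The permutations of {0, ..., h} form 'S_h.+1, and the (h+1)-tuple
   (pi_0, ..., pi_h) is (s 0, ..., s h). The index i : 'I_h stands for the
   pair of consecutive positions i and i + 1. *)
Definition is_ordinal_pattern x s : bool :=
  [forall i : 'I_h,
    let a := s (widen_ord (leqnSn h) i) in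
    let b := s (lift ord0 i) in
    (x b <= x a) && ((x a == x b) ==> (b < a)%N)].

(* The default value 1 is never used: see ordinal_patternP. *)
Definition ordinal_pattern x : 'S_h.+1 :=
  odflt 1%g [pick s | is_ordinal_pattern x s].

(* (y_1, ..., y_h) is (y 0, ..., y (h - 1)). *)
Definition increment_pattern (y : 'I_h -> R) : 'S_h.+1 :=
  ordinal_pattern (fun k : 'I_h.+1 => \sum_(j < h | (j < k)%N) y j).

Let before x (a b : 'I_h.+1) :=
  (x b < x a) || (x a == x b) && (b <= a)%N.

Let before_total x : total (before x).
Proof.
by move=> a b; rewrite /before; case: ltgtP => //= _; exact: leq_total.
Qed.

Let before_trans x : transitive (before x).
Proof.
move=> b a c; rewrite /before => /orP[ab|/andP[/eqP-> ab]].
  by case/orP=> [bc|/andP[/eqP<- _]]; rewrite ?ab// (lt_trans bc ab).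
case/orP=> [->//|/andP[/eqP-> bc]].
by rewrite eqxx (leq_trans bc ab) orbT.
Qed.

Let before_anti x : antisymmetric (before x).
Proof.
move=> a b; rewrite /before.
by case: ltgtP => //= _; rewrite andbC => ?; exact/val_inj/anti_leq.
Qed.

Let is_ordinal_patternE x s :
  is_ordinal_pattern x s = sorted (before x) (codom s).
Proof.
have sz : size (codom s) = h.+1 by rewrite size_codom card_ord.
have nthE (i : 'I_h.+1) : nth ord0 (codom s) i = s i.
  by rewrite (nth_map i) ?size_enum_ord// nth_ord_enum.
apply/forallP/(sortedP ord0) => [H i|H i]; last first.
  have := H i; rewrite sz ltnS ltn_ord => /(_ isT).
  rewrite (nthE (widen_ord (leqnSn h) i)) (nthE (lift ord0 i)) /before /=.
  set a := s (widen_ord _ i); set b := s (lift ord0 i).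
  have ba : b != a.
    by rewrite (inj_eq perm_inj) -val_eqE /= /bump leq0n add1n gtn_eqF.
  case: (ltgtP (x b) (x a)) => //= _ le_ba.
  by rewrite ltn_neqAle le_ba andbT val_eqE.
rewrite sz ltnS => ih; have := H (Ordinal ih).
rewrite (nthE (widen_ord (leqnSn h) (Ordinal ih))) (nthE (lift ord0 (Ordinal ih))).
rewrite /before /=.
by case: (ltgtP (x (s (lift _ _)))) => //= _ /ltnW.
Qed.

Lemma is_ordinal_pattern_exists x : exists s, is_ordinal_pattern x s.
Proof.
pose e := sort (before x) (enum 'I_h.+1).
have sz : size e == h.+1 by rewrite size_sort size_enum_ord.
have tinj : injective (tnth (Tuple sz)).
  by apply/tuple_uniqP; rewrite sort_uniq enum_uniq.
exists (perm tinj); rewrite is_ordinal_patternE.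
suff -> : codom (perm tinj) = e by exact: sort_sorted.
transitivity (val [tuple tnth (Tuple sz) i | i < h.+1]).
  by rewrite /codom /image_mem /=; apply: eq_map => i; rewrite permE.
by rewrite [X in val X](_ : _ = Tuple sz)//; exact/eq_from_tnth/tnth_mktuple.
Qed.

Lemma ordinal_patternP x s :
  reflect (ordinal_pattern x = s) (is_ordinal_pattern x s).
Proof.
have P : is_ordinal_pattern x (ordinal_pattern x).
  rewrite /ordinal_pattern; case: pickP => //= H.
  by have [s' Hs'] := is_ordinal_pattern_exists x; rewrite H in Hs'.
apply: (iffP idP) => [Ps|<-//].
move: P Ps; rewrite !is_ordinal_patternE => P Ps.
have perm_codom (u : 'S_h.+1) : perm_eq (codom u) (enum 'I_h.+1).
  apply: uniq_perm; rewrite ?enum_uniq//.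
    by rewrite map_inj_uniq ?enum_uniq//; exact: perm_inj.
  by move=> i; rewrite mem_enum; apply/codomP; exists (u^-1%g i); rewrite permKV.
have E : codom (ordinal_pattern x) = codom s.
  apply: (sorted_eq (@before_trans x) (@before_anti x)) => //.
  by rewrite (permPl (perm_codom _)) perm_sym.
apply/permP => i; move: E; rewrite !codomE => /eq_in_map; apply.
by rewrite mem_enum.
Qed.

End OrdinalPattern.

Section Process.
Context {d : measure_display} {T : measurableType d} {R : realType}.
Context {P : probability T R}.
Implicit Types (xi Y : nat -> {RV P >-> R}).

(* All finite-dimensional distributions are invariant under time shifts. *)
Definition stationary Y : Prop :=
  forall (n : nat) (t : n.-tuple nat) (k : nat) (B : set (n.-tuple R)),
    measurable B ->
    P [set w | B [tuple Y (tnth t i + k)%N w | i < n]] =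
    P [set w | B [tuple Y (tnth t i) w | i < n]].

(* The product sigma-algebra of the path space. *)
Definition path_measurable : set_system (nat -> R) :=
  <<s [set A | exists (i : nat) (B : set R),
         measurable B /\ A = [set u | B (u i)]] >>.

Definition path_shift (u : nat -> R) : nat -> R := fun i => u i.+1.

(* Used together with stationarity, which makes path_shift preserve the law
   of the process. *)
Definition ergodic Y : Prop :=
  forall A : set (nat -> R),
    path_measurable A -> path_shift @^-1` A = A ->
    P [set w | A (fun i => Y i w)] = 0%E \/
    P [set w | A (fun i => Y i w)] = 1%E.

(* Only meant for 0 < t; since 0.-1 = 0, the value at t = 0 is 0. *)
Definition increment xi (t : nat) : {RV P >-> R} :=
  (xi t : {mfun T >-> R}) \- xi t.-1.

Definition qhat xi (h n : nat) (s : 'S_h.+1) (w : T) : R :=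
  n%:R^-1 *
  \sum_(0 <= i < n)
    \1_[set w' | ordinal_pattern (fun k : 'I_h.+1 => xi (i + k)%N w') = s] w.

Definition pattern_prob xi (h : nat) (s : 'S_h.+1) : R :=
  fine (P [set w |
    increment_pattern (fun j : 'I_h => increment xi j.+1 w) = s]).

Lemma increment_patternE xi (h i : nat) (w : T) :
  increment_pattern (fun j : 'I_h => increment xi (i + j).+1 w) =
  ordinal_pattern (fun k : 'I_h.+1 => xi (i + k)%N w).
Proof.
apply/ordinal_patternP.
have /ordinal_patternP := erefl (ordinal_pattern (fun k : 'I_h.+1 => xi (i + k)%N w)).
rewrite /is_ordinal_pattern; apply: etrans; apply: eq_forallb => j /=.
have E (k : 'I_h.+1) :
    \sum_(j < h | (j < k)%N) increment xi (i + j).+1 w = xi (i + k)%N w - xi i w.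
  rewrite -(big_ord_widen _ (fun j => increment xi (i + j).+1 w)); last first.
    by rewrite -ltnS.
  rewrite -(big_mkord xpredT (fun j => increment xi (i + j).+1 w)).
  rewrite -[in X in _ - X](addn0 i).
  rewrite -(@telescope_sumr _ 0 k (fun j => xi (i + j)%N w))//.
  by apply: eq_bigr => l _; rewrite addnS.
by rewrite !E lerD2r (inj_eq (addIr _)).
Qed.

End Process.

(* Main.v *)
(** Birkhoff's ergodic theorem for bounded functions [G] of finitely many
    consecutive terms, applied to the indicator of the ordinal pattern.
    Write [S_n] for the ergodic sums of a bounded [G]. The event
    [sup_n S_n = +oo] is invariant under the path shift, so by ergodicity it has
    probability 0 or 1. If it has probability 1, Garsia's maximal ergodic
    inequality gives [E G >= 0]; hence if [E G < 0] then [S_n] is almost surely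
    bounded above. Taking [G - E G - 1/k] and [E G - 1/k - G] for [G], for every
    [k], yields [S_n / n --> E G]. *)
Require Import Defs.
From HB Require Import structures.
From mathcomp Require Import all_boot all_order all_algebra perm.
From mathcomp Require Import all_classical all_reals all_analysis.
From mathcomp Require Import measurable_realfun.
From mathcomp Require Import lra.

Set Implicit Arguments.
Unset Strict Implicit.

Import Order.TTheory GRing.Theory Num.Theory.
Import numFieldNormedType.Exports.

Local Open Scope classical_set_scope.
Local Open Scope ring_scope.

(** * Maxima of partial sums of a real sequence *)

Section MaxPartialSum.
Context {R : realType}.
Implicit Types (x y : nat -> R).

(* The maximum of the partial sums of [x] of lengths [0], ..., [N]. *)
Fixpoint max_psum x (N : nat) : R :=
  if N is N'.+1 then Num.max 0 (x 0%N + max_psum (fun i => x i.+1) N') else 0.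

Lemma max_psum_ge0 x N : 0 <= max_psum x N.
Proof. by case: N => //= N; rewrite le_max lexx. Qed.

Lemma eq_max_psum x y N :
  (forall i, (i < N)%N -> x i = y i) -> max_psum x N = max_psum y N.
Proof.
elim: N x y => //= N IH x y xy; rewrite xy//.
by rewrite (IH _ (fun i => y i.+1))// => i iN; exact: xy.
Qed.

Lemma max_psum_leS x N : max_psum x N <= max_psum x N.+1.
Proof.
elim: N x => [|N IH] x; first exact: max_psum_ge0.
change (Num.max 0 (x 0%N + max_psum (fun i => x i.+1) N) <=
  Num.max 0 (x 0%N + max_psum (fun i => x i.+1) N.+1)).
by rewrite ge_max !le_max lexx/= lerD2l IH orbT.
Qed.

Lemma le_max_psum x n N : (n <= N)%N -> \sum_(0 <= i < n) x i <= max_psum x N.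
Proof.
elim: N n x => [|N IH] [|n] x//; first by rewrite big_geq.
  by rewrite big_geq// max_psum_ge0.
by move=> nN; rewrite big_nat_recl//= le_max lerD2l IH ?orbT.
Qed.

Lemma max_psum_attained x N : exists n, max_psum x N = \sum_(0 <= i < n) x i.
Proof.
elim: N x => [|N IH] x /=; first by exists 0%N; rewrite big_geq.
have [_|_] := leP 0 (x 0%N + _); last by exists 0%N; rewrite big_geq.
by have [n ->] := IH (fun i => x i.+1); exists n.+1; rewrite big_nat_recl.
Qed.

Lemma max_psum_le x (B : R) N :
  0 <= B -> (forall i, x i <= B) -> max_psum x N <= B *+ N.
Proof.
move=> B0; elim: N x => // N IH x xB /=.
by rewrite ge_max mulrn_wge0//= mulrS lerD// IH.
Qed.

(** Pointwise form of Garsia's argument. A positive maximum is attained by a nonempty sum, so it is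
    [x 0] plus a maximum of the shifted sequence over at most [N - 1] terms. Otherwise the left side
    is at most 0, and the term [B] makes up for [x 0 >= - B]. *)
Lemma max_psum_shift x (B : R) N : (forall i, `|x i| <= B) ->
  max_psum x N <=
    x 0%N + max_psum (fun i => x i.+1) N + B * (max_psum x N <= 0)%R%:R.
Proof.
move=> xB; have := xB 0%N; rewrite ler_norml => /andP[B0 _].
have := max_psum_ge0 (fun i => x i.+1) N.
case: (lerP (max_psum x N) 0) => [? ?|]; first by rewrite mulr1n mulr1; lra.
case: N => [|N]; first by rewrite ltxx.
rewrite /= lt_max ltxx/= => M0 _.
rewrite mulr0n mulr0 addr0 max_r; last exact: ltW.
by rewrite lerD2l; exact: (max_psum_leS (fun i => x i.+1)).
Qed.

Lemma measurable_max_psum {d} {V : measurableType d} (X : nat -> V -> R) N :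
  (forall i, measurable_fun setT (X i)) ->
  measurable_fun setT (fun v => max_psum (X^~ v) N).
Proof.
elim: N X => [|N IH] X mX /=; first exact: measurable_cst.
apply: measurable_maxr; first exact: measurable_cst.
by apply: measurable_funD => //; exact: (IH (fun i => X i.+1)).
Qed.

Lemma measurable_psum_gt {d} {V : measurableType d} (X : nat -> V -> R)
    (c : R) :
  (forall i, measurable_fun setT (X i)) ->
  measurable [set v | exists n, c < \sum_(0 <= i < n) X i v].
Proof.
move=> mX; rewrite [X in measurable X](_ : _ =
  \bigcup_n [set v | c < \sum_(0 <= i < n) X i v]); last first.
  by apply/seteqP; split=> v /= => [[n]|[n _]]; exists n.
apply: bigcupT_measurable => n; rewrite -[X in measurable X]setTI.
have /(_ measurableT [set true]) := measurable_fun_ltr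
  (measurable_cst c) (@measurable_sum _ V R setT _ (index_iota 0 n) _ mX).
exact.
Qed.

End MaxPartialSum.

(** * The maximal ergodic inequality *)

Section MaximalErgodic.
Context {d : measure_display} {T : measurableType d} {R : realType}.
Variables (P : probability T R) (X : nat -> T -> R) (B : R).
Hypothesis mX : forall i, measurable_fun setT (X i).
Hypothesis XB : forall i w, `|X i w| <= B.
Hypothesis max_psum_stationary : forall N,
  \int[P]_w max_psum (fun i => X i.+1 w) N = \int[P]_w max_psum (X^~ w) N.

Lemma bounded_integrable (f : T -> R) (C : R) :
  measurable_fun setT f -> (forall w, `|f w| <= C) ->
  P.-integrable setT (EFin \o f).
Proof.
move=> mf fC; apply: measurable_bounded_integrable => //.
  by rewrite (le_lt_trans (probability_le1 _ measurableT))// ltry.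
exists C; split; first exact: num_real.
by move=> M CM w _; exact: le_trans (fC w) (ltW CM).
Qed.


Let E N := [set w | max_psum (X^~ w) N <= 0].

Let mE N : measurable (E N).
Proof.
rewrite -[X in measurable X]setTI.
have /(_ measurableT [set true]) := @measurable_fun_ler _ T R setT
  (fun w => max_psum (X^~ w) N) (cst 0) (measurable_max_psum N mX)
  (measurable_cst _).
exact.
Qed.

(** Integrate [max_psum_shift]: by [max_psum_stationary] the integrals of the two maxima cancel. The
    error term [B * P (E N)] stands in for restricting the integral of [X 0] to the complement of
    [E N]. *)
Lemma maximal_ergodic N : 0 <= \int[P]_w X 0%N w + B * fine (P (E N)).
Proof.
have B0 : 0 <= B by apply: le_trans (XB 0%N point).
have iM (Y : nat -> T -> R) : (forall i, measurable_fun setT (Y i)) ->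
    (forall i w, `|Y i w| <= B) ->
    P.-integrable setT (EFin \o (fun w => max_psum (Y^~ w) N)).
  move=> mY YB; apply: (@bounded_integrable _ (B *+ N)).
    exact: measurable_max_psum.
  move=> w; rewrite ger0_norm ?max_psum_ge0// max_psum_le// => i.
  exact: le_trans (ler_norm _) (YB i w).
have iX : P.-integrable setT (EFin \o X 0%N).
  exact: bounded_integrable (mX 0) (XB 0).
have iXM : P.-integrable setT
    (EFin \o (fun w => X 0%N w + max_psum (fun i => X i.+1 w) N)).
  apply: (@bounded_integrable _ (B + B *+ N)) => [|w].
    apply: measurable_funD => //.
    exact: (@measurable_max_psum _ _ _ (fun i => X i.+1)).
  rewrite (le_trans (ler_normD _ _))// lerD// ger0_norm ?max_psum_ge0//.
  by rewrite max_psum_le// => i; exact: le_trans (ler_norm _) (XB _ w).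
have iE : P.-integrable setT (EFin \o (fun w => B * \1_(E N) w)).
  apply: (@bounded_integrable _ B) => [|w].
    by apply: measurable_funM => //; exact: measurable_cst.
  rewrite normrM ger0_norm// ler_piMr// indicE.
  by case: (_ \in _); rewrite ?normr1 ?normr0.
have : \int[P]_w max_psum (X^~ w) N <= \int[P]_w
    (X 0%N w + max_psum (fun i => X i.+1 w) N + B * \1_(E N) w).
  apply: le_Rintegral => //; first exact: iM.
    exact: (integrableD measurableT iXM iE).
  move=> w _; rewrite indicE /E.
  rewrite (_ : (w \in _) = (max_psum (X^~ w) N <= 0)); last first.
    by apply/idP/idP => [/set_mem|/mem_set].
  exact: max_psum_shift.
rewrite RintegralD// RintegralD//; last exact: (iM (fun i => X i.+1)).
rewrite max_psum_stationary RintegralZl//; last first.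
  apply: (@bounded_integrable _ 1) => // w.
  by rewrite indicE; case: (_ \in _); rewrite ?normr1 ?normr0.
rewrite [X in B * X](_ : _ = fine (P (E N))); last first.
  by rewrite /Rintegral integral_indic// setIT.
lra.
Qed.

(** The sets [E N] decrease to the event that no partial sum is positive, which is null here. By
    continuity from above the error term of [maximal_ergodic] tends to 0. *)
Lemma mean_ge0_of_psum_gt0 :
  P [set w | exists n, 0 < \sum_(0 <= i < n) X i w] = 1%E ->
  0 <= \int[P]_w X 0%N w.
Proof.
move=> P1.
have capE : \bigcap_N E N = ~` [set w | exists n, 0 < \sum_(0 <= i < n) X i w].
  apply/seteqP; split=> w /=.
    move=> Ew [n]; apply/negP; rewrite -leNgt.
    by rewrite (le_trans (le_max_psum (X^~ w) (leqnn n)))// (Ew n).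
  move=> nX N _; rewrite /E/=; have [//|M0] := leP (max_psum (X^~ w) N) 0.
  have [n Mn] := max_psum_attained (X^~ w) N.
  by exfalso; apply: nX; exists n; rewrite -Mn.
have mcap : measurable (\bigcap_N E N) by apply: bigcapT_measurable.
have P0 : P (\bigcap_N E N) = 0%:E.
  rewrite capE probability_setC ?P1 ?subee//.
  by rewrite -[X in measurable X]setCK -capE; exact: measurableC.
have cvE : fine (P (E N)) @[N --> \oo] --> (0 : R).
  apply: fine_cvg; rewrite -P0; apply: nonincreasing_cvg_mu => //.
    by rewrite -ge0_fin_numE// fin_num_measure.
  apply/nonincreasing_seqP => N; apply/subsetPset => w.
  exact/le_trans/max_psum_leS.
have : (\int[P]_w X 0%N w + B * fine (P (E N))) @[N --> \oo] -->
    (\int[P]_w X 0%N w + B * 0).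
  by apply: cvgD; [exact: cvg_cst | apply: cvgM => //; exact: cvg_cst].
rewrite mulr0 addr0 => cv; rewrite -(cvg_lim _ cv)//.
apply: limr_ge; first by apply/cvg_ex; eexists; exact: cv.
by apply: nearW => N; exact: maximal_ergodic.
Qed.

End MaximalErgodic.

(** * Ergodic sums of a function with negative mean *)

Definition window {R : Type} (m i : nat) (u : nat -> R) : m.-tuple R :=
  [tuple u (i + j)%N | j < m].

Section NegativeMean.
Context {d : measure_display} {T : measurableType d} {R : realType}.
Context {P : probability T R}.
Variables (Y : nat -> {RV P >-> R}) (m : nat) (G : m.-tuple R -> R) (B : R).
Hypothesis stat : stationary Y.
Hypothesis erg : ergodic Y.
Hypothesis mG : measurable_fun setT G.
Hypothesis GB : forall t, `|G t| <= B.

Lemma measurable_window {d'} {V : measurableType d'} (Z : nat -> V -> R) n i :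
  (forall i, measurable_fun setT (Z i)) ->
  measurable_fun setT (fun v => window n i (Z^~ v)).
Proof.
move=> mZ; apply/measurable_fun_tnthP => j.
by apply: eq_measurable_fun (mZ (i + j)%N) => v _ /=; rewrite tnth_mktuple.
Qed.

Let X i w := G (window m i (Y^~ w)).

Let mX i : measurable_fun setT (X i).
Proof. by apply: measurableT_comp => //; exact: measurable_window. Qed.

(** Both sides are integrals of [F] against the law of a window, and stationarity at the times
    [0, ..., n - 1] with shift 1 makes the two laws equal. Nonnegativity of [F] permits the change
    of variables without an integrability condition. *)
Lemma stationary_Rintegral n (F : n.-tuple R -> R) :
  measurable_fun setT F -> (forall t, 0 <= F t) ->
  \int[P]_w F (window n 1 (Y^~ w)) = \int[P]_w F (window n 0 (Y^~ w)).
Proof.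
move=> mF F0; congr fine.
pose W i : {mfun T >-> n.-tuple R} := HB.pack (fun w => window n i (Y^~ w))
  (isMeasurableFun.Build _ _ _ _ _
    (@measurable_window _ _ (fun i => Y i) n i (fun=> measurable_funPT _))).
have mF' : measurable_fun setT (EFin \o F) by exact/measurable_EFinP.
have pf i : (\int[P]_w (F (window n i (Y^~ w)))%:E =
    \int[distribution P (W i)]_t (F t)%:E)%E.
  by rewrite ge0_integral_distribution.
rewrite !pf; apply: eq_measure_integral => A mA _.
have wE k w : window n k (Y^~ w) =
    [tuple Y (tnth [tuple val i | i < n] j + k)%N w | j < n].
  by apply: eq_from_tnth => j; rewrite !tnth_mktuple addnC.
have w0E w : window n 0 (Y^~ w) =
    [tuple Y (tnth [tuple val i | i < n] j) w | j < n].
  by apply: eq_from_tnth => j; rewrite !tnth_mktuple.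
transitivity (P [set w |
    A [tuple Y (tnth [tuple val i | i < n] j + 1)%N w | j < n]]).
  by congr (P _); apply/seteqP; split=> w /=; rewrite wE.
rewrite stat//.
by congr (P _); apply/seteqP; split=> w /=; rewrite w0E.
Qed.

(** The first [N] windows of length [m] read only coordinates below [N + m], so the maximum is a
    function of a single finite window, to which [stationary_Rintegral] applies. The default value
    of [nth] is never reached. *)
Let max_psumE i N w : max_psum (fun k => X (i + k)%N w) N =
  max_psum (fun k => G (window m k (fun l => (window (N + m) i (Y^~ w))`_l))) N.
Proof.
apply: eq_max_psum => k kN; congr (G _); apply: eq_from_tnth => j.
rewrite !tnth_mktuple.
have kj : (k + j < N + m)%N by rewrite -addSn leq_add// ltnW.
by rewrite (nth_map (Ordinal kj)) ?size_enum_ord// nth_enum_ord ?addnA.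
Qed.

Lemma psum_bounded_of_neg_mean : \int[P]_w G (window m 0 (Y^~ w)) < 0 ->
  {ae P, forall w, exists K : nat, forall n,
    \sum_(0 <= i < n) G (window m i (Y^~ w)) <= K%:R}.
Proof.
move=> neg.
(* [path_measurable] is, by conversion, the sigma-algebra of [V]. *)
pose S : set_system (nat -> R) := [set A | exists (i : nat) (B : set R),
  measurable B /\ A = [set u | B (u i)]].
pose V := g_sigma_algebraType S.
(* The event that the ergodic sums are unbounded above, taken in path space so that ergodicity
   applies to it. *)
pose U (v : nat -> R) := forall K : nat, exists n,
  K%:R < \sum_(0 <= i < n) G (window m i v).
have mc i : measurable_fun setT (fun v : V => v i).
  move=> _ C mC; rewrite setTI; apply: sub_sigma_algebra.
  by exists i, C.
have mU : measurable ([set v | U v] : set V).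
  rewrite [X in measurable X](_ : _ = \bigcap_(K : nat)
      [set v : V | exists n,
        K%:R < \sum_(0 <= i < n) G (window m i v)]); last first.
    by apply/seteqP; split=> v /= Uv K => [_|]; exact: Uv.
  apply: bigcapT_measurable => K.
  apply: (@measurable_psum_gt R _ V (fun i v => G (window m i v))) => i.
  apply: measurableT_comp => //.
  exact: (@measurable_window _ V (fun i v => v i)).
have shiftU : path_shift @^-1` [set v | U v] = [set v | U v].
  have sE n v : \sum_(0 <= i < n.+1) G (window m i v) =
      G (window m 0 v) + \sum_(0 <= i < n) G (window m i (path_shift v)).
    by rewrite big_nat_recl.
  (* Adding or removing the first term changes a sum by at most [b], so exceeding [K + b] for one of
     the two paths forces exceeding [K] for the other. *)
  have [b Bb] : exists b : nat, B <= b%:R.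
    exists (Num.bound B); rewrite ltW// archi_boundP//.
    by rewrite (le_trans _ (GB (nseq_tuple m 0))).
  apply/seteqP; split=> v Uv K /=; have [n Kn] := Uv (K + b)%N.
    exists n.+1; rewrite sE; have := GB (window m 0 v).
    by move: Kn; rewrite natrD ler_norml => + /andP[]; lra.
  case: n Kn => [|n]; first by rewrite big_geq// ltrn0.
  rewrite sE natrD => Kn; exists n; have := GB (window m 0 v).
  by rewrite ler_norml => /andP[]; lra.
have mTU : measurable [set w | U (Y^~ w)].
  rewrite (_ : [set w | _] = \bigcap_(K : nat)
      [set w | exists n, K%:R < \sum_(0 <= i < n) X i w]).
    by apply: bigcapT_measurable => K; exact: measurable_psum_gt.
  by apply/seteqP; split=> w /= Uw K => [_|]; exact: Uw.
have [P0|P1] := erg mU shiftU.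
  exists [set w | U (Y^~ w)]; split => // w /= nb K.
  apply: contrapT => nK; apply: nb; exists K => n.
  by rewrite leNgt; apply/negP => Kn; apply: nK; exists n.
(* If [U] has probability 1, then almost surely some sum is positive (the case [K = 0]), so the mean
   would be nonnegative. *)
exfalso; move: neg; rewrite ltNge => /negP; apply.
apply: (@mean_ge0_of_psum_gt0 _ _ _ P X B) => // [i w|N|].
- exact: GB.
- pose F (t : (N + m).-tuple R) :=
    max_psum (fun k => G (window m k (fun l => t`_l))) N.
  have FE i w : max_psum (fun k => X (i + k)%N w) N =
      F (window (N + m) i (Y^~ w)).
    exact: max_psumE.
  transitivity (\int[P]_w F (window (N + m) 1 (Y^~ w))).
    by apply: eq_Rintegral => w _; rewrite -FE.
  rewrite stationary_Rintegral.
  + by apply: eq_Rintegral => w _; rewrite -FE.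
  + apply: (@measurable_max_psum R _ ((N + m).-tuple R : measurableType _)
      (fun k (t : (N + m).-tuple R) => G (window m k (fun l => t`_l)))) => k.
    apply: measurableT_comp => //.
    apply: (@measurable_window _ _ (fun l (t : (N + m).-tuple R) => t`_l)) => l.
    (* [measurable_window] asks for measurability of every coordinate; past the end of the tuple the
       coordinate is the constant default 0. *)
    have [lN|Nl] := ltnP l (N + m).
      apply: eq_measurable_fun (measurable_tnth (Ordinal lN)) => t _.
      by rewrite (tnth_nth 0).
    rewrite (_ : (fun _ => _) = cst 0); first exact: measurable_cst.
    by apply/funext => t; rewrite nth_default// size_tuple.
  + by move=> t; exact: max_psum_ge0.
- have m0 : measurable [set w | exists n, 0 < \sum_(0 <= i < n) X i w].
    exact: measurable_psum_gt.
  apply/eqP; rewrite eq_le probability_le1//= -P1 le_measure ?inE//.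
  by move=> w Uw; exact: (Uw 0%N).
Qed.

End NegativeMean.

(** * From bounded centred sums to Birkhoff's theorem *)

Lemma cvg_mean {R : realType} (x : nat -> R) (l : R) :
  (forall k, exists K : nat, forall n,
    \sum_(0 <= i < n) (x i - (l + k.+1%:R^-1)) <= K%:R) ->
  (forall k, exists K : nat, forall n,
    \sum_(0 <= i < n) (l - k.+1%:R^-1 - x i) <= K%:R) ->
  (fun n => n%:R^-1 * \sum_(0 <= i < n) x i) @ \oo --> l.
Proof.
move=> ub lb; apply/cvgrPdist_le => e e0.
have e20 : 0 < e / 2 by rewrite divr_gt0.
(* Half of [e] absorbs the offset [1 / (k + 1)]; the other half absorbs [K1 / n] and [K2 / n] for
   large [n]. *)
have [k ke] : exists k : nat, k.+1%:R^-1 <= e / 2.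
  have eb : (e / 2)^-1 < (Num.bound (e / 2)^-1)%:R.
    by rewrite archi_boundP// invr_ge0 ltW.
  exists (Num.bound (e / 2)^-1).
  rewrite -[leRHS]invrK lef_pV2 ?posrE ?invr_gt0//.
  by rewrite (le_trans (ltW eb))// ler_nat.
have [K1 ubK] := ub k; have [K2 lbK] := lb k.
have sumc (c : R) n : \sum_(0 <= i < n) c = n%:R * c.
  by rewrite sumr_const_nat subn0 mulr_natl.
near=> n.
have n0 : 0 < n%:R :> R by rewrite ltr0n; near: n; exists 1%N.
have K1n : K1%:R <= n%:R * (e / 2).
  by rewrite -ler_pdivrMr//; near: n; exact: nbhs_infty_ger.
have K2n : K2%:R <= n%:R * (e / 2).
  by rewrite -ler_pdivrMr//; near: n; exact: nbhs_infty_ger.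
have := ubK n; have := lbK n; rewrite !sumrB !sumc => lbn ubn.
have kn := ler_wpM2l (ltW n0) ke.
rewrite -(ler_pM2l n0) -{1}(ger0_norm (ltW n0)) -normrM mulrBr.
rewrite mulrA divff ?gt_eqF// mul1r.
move: (k.+1%:R^-1) (\sum_(0 <= i < n) x i) lbn ubn kn => c S lbn ubn kn.
by rewrite ler_norml; apply/andP; split; nra.
Unshelve. all: by end_near. Qed.

Theorem birkhoff_window {d} {T : measurableType d} {R : realType}
    {P : probability T R} (Y : nat -> {RV P >-> R}) (m : nat)
    (G : m.-tuple R -> R) (B : R) :
  stationary Y -> ergodic Y ->
  measurable_fun setT G -> (forall t, `|G t| <= B) ->
  {ae P, forall w,
    (fun n => n%:R^-1 * \sum_(0 <= i < n) G (window m i (Y^~ w))) @ \oo -->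
    \int[P]_w G (window m 0 (Y^~ w))}.
Proof.
move=> stat erg mG GB; set l := \int[P]_w _.
have mGw : measurable_fun setT (fun w => G (window m 0 (Y^~ w))).
  by apply: measurableT_comp => //; exact: measurable_window.
have iG : P.-integrable setT (EFin \o (fun w => G (window m 0 (Y^~ w)))).
  exact: (bounded_integrable P mGw (fun w => GB _)).
have ic (c : R) : P.-integrable setT (EFin \o (fun _ : T => c)).
  exact: (@bounded_integrable _ _ _ _ _ `|c|).
have intc (c : R) : \int[P]_w c = c.
  by rewrite Rintegral_cst//= probability_setT mulr1.
(* The centred function has mean [- 1 / (k + 1) < 0]. As there are countably many [k], one null set
   serves them all; [lb] is symmetric. *)
have ub : {ae P, forall w, forall k, exists K : nat, forall n,
    \sum_(0 <= i < n) (G (window m i (Y^~ w)) - (l + k.+1%:R^-1)) <= K%:R}.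
  apply: ae_foralln => k.
  apply: (@psum_bounded_of_neg_mean _ _ _ _ Y m
    (fun t => G t - (l + k.+1%:R^-1)) (B + `|l + k.+1%:R^-1|)) => //.
  - by apply: measurable_funB => //; exact: measurable_cst.
  - by move=> t; rewrite (le_trans (ler_normB _ _))// lerD2r.
  rewrite RintegralB// intc -/l opprD addrA subrr sub0r oppr_lt0.
  by rewrite invr_gt0.
have lb : {ae P, forall w, forall k, exists K : nat, forall n,
    \sum_(0 <= i < n) (l - k.+1%:R^-1 - G (window m i (Y^~ w))) <= K%:R}.
  apply: ae_foralln => k.
  apply: (@psum_bounded_of_neg_mean _ _ _ _ Y m
    (fun t => l - k.+1%:R^-1 - G t) (`|l - k.+1%:R^-1| + B)) => //.
  - by apply: measurable_funB => //; exact: measurable_cst.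
  - by move=> t; rewrite (le_trans (ler_normB _ _))// lerD2l.
  rewrite RintegralB// intc -/l addrAC subrr sub0r oppr_lt0.
  by rewrite invr_gt0.
by apply: filterS2 ub lb => w; exact: cvg_mean.
Qed.

(** * Application to ordinal patterns *)

Lemma measurable_increment_pattern {R : realType} h (s : 'S_h.+1) :
  measurable [set t : h.-tuple R | increment_pattern (tnth t) = s].
Proof.
pose x (t : h.-tuple R) (k : 'I_h.+1) := \sum_(j < h | (j < k)%N) tnth t j.
have mx k : measurable_fun setT (x^~ k).
  rewrite /x; under eq_fun do rewrite big_mkcond.
  apply: measurable_sum => j.
  by case: (j < k)%N; [exact: measurable_tnth|exact: measurable_cst].
pose a (i : 'I_h) := s (widen_ord (leqnSn h) i).
pose b (i : 'I_h) := s (lift ord0 i).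
(* By [ordinal_patternP] the pattern is decided by finitely many comparisons between partial sums,
   which are measurable in the tuple. *)
rewrite [X in measurable X](_ : _ = \bigcap_(i in [set: 'I_h])
    [set t | (x t (b i) <= x t (a i)) &&
             ((x t (a i) == x t (b i)) ==> (b i < a i)%N)]); last first.
  apply/seteqP; split=> t /=.
    by move=> /ordinal_patternP/forallP tp i _; exact: tp.
  by move=> tp; apply/ordinal_patternP/forallP => i; exact: tp.
apply: fin_bigcap_measurable => // i _; rewrite -[X in measurable X]setTI.
suff mi : measurable_fun setT (fun t => (x t (b i) <= x t (a i)) &&
    ((x t (a i) == x t (b i)) ==> (b i < a i)%N)).
  by have := mi measurableT [set true]; exact.
apply: measurable_and; first exact: measurable_fun_ler.
under eq_fun do rewrite implybE.
apply: measurable_or; last exact: measurable_cst.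
by apply: measurable_neg; exact: measurable_fun_eqr.
Qed.

Unset Implicit Arguments.
Set Strict Implicit.

Theorem theorem3p3 (d : measure_display) (T : measurableType d) (R : realType)
    (P : probability T R) (h : nat) (s : 'S_h.+1)
    (xi : nat -> {RV P >-> R})
    (stat : stationary (fun i => increment xi i.+1))
    (erg : ergodic (fun i => increment xi i.+1)) :
  {ae P, forall w, (fun n => qhat xi n s w) @ \oo --> pattern_prob xi s}.
Proof.
pose D := [set t : h.-tuple R | increment_pattern (tnth t) = s].
have mD : measurable D by exact: measurable_increment_pattern.
have D1 t : `|\1_D t| <= 1 :> R.
  by rewrite indicE; case: (_ \in _); rewrite ?normr1 ?normr0.
(* Because of the shift to [j.+1], the window at [i] holds the increments from time [i + 1] to
   [i + h], which determine the pattern of [xi] from [i] to [i + h]. *)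
have DE i w : D (window h i (fun j => increment xi j.+1 w)) =
    (ordinal_pattern (fun k : 'I_h.+1 => xi (i + k)%N w) = s).
  rewrite /D/= -increment_patternE; congr (increment_pattern _ = s).
  by apply/funext => j; rewrite tnth_mktuple.
(* The limit given by [birkhoff_window] for the indicator of [D] is the probability of the
   pattern. *)
have pE : pattern_prob xi s =
    \int[P]_w \1_D (window h 0 (fun j => increment xi j.+1 w)).
  pose W w := window h 0 (fun j => increment xi j.+1 w).
  have mW : measurable_fun setT W.
    exact: (@measurable_window _ _ _ (fun j => increment xi j.+1)).
  have mWD : measurable (W @^-1` D).
    by rewrite -[X in measurable X]setTI; exact: mW.
  rewrite /pattern_prob; transitivity (\int[P]_w \1_(W @^-1` D) w) => [|//].
  rewrite /Rintegral integral_indic// setIT; congr (fine (P _)).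
  by apply/seteqP; split=> w; rewrite /= DE -increment_patternE.
rewrite pE; apply: filterS (birkhoff_window stat erg (measurable_indic mD) D1).
move=> w; rewrite (_ : (fun n => qhat xi n s w) = (fun n => n%:R^-1 *
  \sum_(0 <= i < n) \1_D (window h i (fun j => increment xi j.+1 w))))//.
apply/funext => n; congr (_ * _).
apply: eq_bigr => i _; rewrite !indicE; congr ((nat_of_bool _)%:R).
by apply/idP/idP => /set_mem H; apply/mem_set; move: H; rewrite /= DE.
Qed.
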